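(* For every $t\ge0$, the conditional means $\mathbb E_i[X(t)]=\mathbb E[X(t)\mid\varepsilon(0)=i]$, where $X(0)=x$, are $$\mathbb E_0[X(t)]=x\,\psi_0^\Gamma(t)+a_0\int_0^t\pi_{00}(s)\psi_0^\Gamma(t-s)\,ds+a_1\int_0^t\pi_{01}(s)\psi_1^\Gamma(t-s)\,ds,$$ $$\mathbb E_1[X(t)]=x\,\psi_1^\Gamma(t)+a_0\int_0^t\pi_{10}(s)\psi_0^\Gamma(t-s)\,ds+a_1\int_0^t\pi_{11}(s)\psi_1^\Gamma(t-s)\,ds.$$
   Context: Let $\varepsilon=\varepsilon(t)\in\{0,1\}$, $t\ge0$, be a time-homogeneous two-state Markov process with positive switching intensities $\lambda_0,\lambda_1$: $\mathbb P\{\varepsilon(t+dt)=i\mid\varepsilon(t)=i\}=1-\lambda_i\,dt+o(dt)$, $dt\to 0$. Let $a_0,a_1\in\mathbb R$ and $\gamma_0,\gamma_1>0$ with $a_0/\gamma_0>a_1/\gamma_1$. The Ornstein-Uhlenbeck process of bounded variation $X=X(t)$ is the path-continuous solution of $dX(t)=(a_{\varepsilon(t)}-\gamma_{\varepsilon(t)}X(t))\,dt$, $X(0)=x$; equivalently $X(t)=e^{-\Gamma(t)}\bigl(x+\int_0^te^{\Gamma(s)}a_{\varepsilon(s)}\,ds\bigr)$ with $\Gamma(t)=\int_0^t\gamma_{\varepsilon(s)}\,ds$. Let $N(s)$ be the number of switchings of $\varepsilon$ up to time $s$ and let $\mathbb P_i$, $\mathbb E_i$ denote probability and expectation conditional on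 $\varepsilon(0)=i$. Then $\pi_{ii}(s)=\mathbb P_i\{N(s)\text{ is even}\}$ and $\pi_{i,1-i}(s)=\mathbb P_i\{N(s)\text{ is odd}\}$, i.e. $\pi_{ik}(s)=\mathbb P\{\varepsilon(s)=k\mid\varepsilon(0)=i\}$; and $\psi_k^\Gamma(t)=\mathbb E_k\bigl[\exp\bigl(-\int_0^t\gamma_{\varepsilon(s)}\,ds\bigr)\bigr]$, $k\in\{0,1\}$. Known explicit expressions for these quantities: with $\Phi(\alpha,\beta;z)=\sum_{n\ge0}\frac{(\alpha)_n}{(\beta)_n}\frac{z^n}{n!}$ the confluent hypergeometric function, where $(\alpha)_n=\alpha(\alpha+1)\cdots(\alpha+n-1)$, $(\alpha)_0=1$, and $$\Psi_0(t,z)=\sum_{n=1}^\infty\frac{\lambda_0^n\lambda_1^n}{(2n)!}t^{2n}\Phi(n,2n+1;z),\qquad \Psi_1(t,z)=\sum_{n=1}^\infty\frac{\lambda_0^{n-1}\lambda_1^{n-1}}{(2n-1)!}t^{2n-1}\Phi(n,2n;z),$$ one has, for $i\in\{0,1\}$ and $j=1-i$, $\pi_{ii}(s)=e^{-\lambda_is}[1+\Psi_0(s,(\lambda_i-\lambda_j)s)]$, $\pi_{ij}(s)=\lambda_ie^{-\lambda_is}\Psi_1(s,(\lambda_i-\lambda_j)s)$, and $$\psi_i^\Gamma(t)=e^{-(\lambda_i+\gamma_i)t}\bigl[1+\Psi_0(t,(\lambda_i-\lambda_j+\gamma_i-\gamma_j)t)+\lambda_i\Psi_1(t,(\lambda_i-\lambda_j+\gamma_i-\gamma_j)t)\bigr].$$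 *)

(* Defs.v *)
From HB Require Import structures.
From mathcomp Require Import all_boot all_order all_algebra finmap.
From mathcomp Require Import all_classical all_reals all_analysis.
Set Implicit Arguments. Unset Strict Implicit. Unset Printing Implicit Defensive.
Import Order.TTheory GRing.Theory Num.Theory.
Import numFieldNormedType.Exports.
Local Open Scope classical_set_scope.
Local Open Scope ring_scope.

(* The states 0 and 1 are encoded by the booleans false and true, so that
   j = 1 - i is [~~ i].  Processes are indexed by all of R, but only their
   values at times t >= 0 matter. *)

Section Conditioning.
Context {R : realType} {d : measure_display} {T : measurableType d}.
Variable P : probability T R.

(* P (A | B) and E [X | B] for an event B with P B > 0. *)
Definition cprob (A B : set T) : R := fine (P (A `&` B)) / fine (P B).

(* Valued in the extended reals, so that an equation with a real right-hand
   side asserts in particular that the expectation is finite. *)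
Definition cexp (X : T -> R) (B : set T) : \bar R :=
  ((fine (P B))^-1%:E * \int[P]_(w in B) (X w)%:E)%E.

End Conditioning.

Section Path.
Context {R : realType}.
Local Notation mu := (@lebesgue_measure R).

(* Right-continuity with left limits, for the discrete topology on {0, 1}. *)
Definition cadlag_path (e : R -> bool) : Prop :=
  (forall t : R, 0 <= t -> \forall u \near t^'+, e u = e t) /\
  (forall t : R, 0 < t -> exists b, \forall u \near t^'-, e u = b).

Definition switching_times (e : R -> bool) (s : R) : set R :=
  [set u | 0 < u <= s /\ \forall v \near u^'-, e v != e u].

(* A cadlag path has finitely many switchings in ]0, s]; on such paths the
   default value 0 of fset_set's cardinal on infinite sets is never used. *)
Definition nb_switchings (e : R -> bool) (s : R) : nat :=
  #|` fset_set (switching_times e s)|.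

Definition Gamma (gamma : bool -> R) (e : R -> bool) (t : R) : R :=
  \int[mu]_(s in `[0, t]) gamma (e s).

(* dX(t) = (a_e(t) - gamma_e(t) X(t)) dt, X(0) = x, along the path e: the
   differential equation is understood in integral form, since the right-hand
   side jumps at the switching times. *)
Definition ou_path (a gamma : bool -> R) (x : R) (e : R -> bool) (X : R -> R) : Prop :=
  [/\ X 0 = x,
      {within `[0, +oo[, continuous X} &
      forall t : R, 0 <= t ->
        X t = x + \int[mu]_(s in `[0, t]) (a (e s) - gamma (e s) * X s)].

End Path.

Section Process.
Context {R : realType} {d : measure_display} {T : measurableType d}.
Variables (P : probability T R) (eps : R -> T -> bool).

Definition in_state (t : R) (i : bool) : set T := [set w | eps t w = i].

Definition natural_filtration (s : R) : set (set T) :=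
  <<s [set A | exists (u : R) (i : bool), 0 <= u <= s /\ A = in_state u i] >>.

Record two_state_markov (lambda : bool -> R) : Prop := {
  tsm_measurable : forall (t : R) (i : bool), 0 <= t -> measurable (in_state t i);
  tsm_cadlag : forall w, cadlag_path (eps ^~ w);
  tsm_markov : forall (s t : R) (i k : bool) (A : set T), 0 <= s -> 0 <= t ->
    natural_filtration s A -> (0 < P (A `&` in_state s i))%E ->
    cprob P (in_state (s + t) k) (A `&` in_state s i) =
    cprob P (in_state (s + t) k) (in_state s i);
  tsm_homogeneous : forall (s s' t : R) (i k : bool), 0 <= s -> 0 <= s' -> 0 <= t ->
    (0 < P (in_state s i))%E -> (0 < P (in_state s' i))%E ->
    cprob P (in_state (s + t) k) (in_state s i) =
    cprob P (in_state (s' + t) k) (in_state s' i);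
  tsm_intensity : forall (t : R) (i : bool), 0 <= t -> (0 < P (in_state t i))%E ->
    (fun h : R^o => cprob P (in_state (t + h) i) (in_state t i)
                      - (1 - lambda i * h) : R^o) =o_ (0^'+) (fun h : R^o => h)
}.

Definition transition (i k : bool) (s : R) : R :=
  if k == i
  then cprob P [set w | ~~ odd (nb_switchings (eps ^~ w) s)] (in_state 0 i)
  else cprob P [set w | odd (nb_switchings (eps ^~ w) s)] (in_state 0 i).

Definition psiGamma (gamma : bool -> R) (k : bool) (t : R) : R :=
  fine (cexp P (fun w => expR (- Gamma gamma (eps ^~ w) t)) (in_state 0 k)).

End Process.

(* Main.v *)
Require Import Defs.
From HB Require Import structures.
From mathcomp Require Import all_boot all_order all_algebra finmap.
From mathcomp Require Import all_classical all_reals all_analysis.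
From mathcomp Require Import measurable_realfun lra ring.
Import Order.TTheory GRing.Theory Num.Theory.
Import numFieldNormedType.Exports.
Local Open Scope classical_set_scope.
Local Open Scope ring_scope.

(** Along a fixed path [e] of the switching process the equation is linear, and
    the integrating factor [exp (Gamma t)] gives (ou_path_formula)
      [X t = x exp (- Gamma t) + int_0^t a (e s) exp (- (Gamma t - Gamma s)) ds].
    The factor [a (e s)] equals [a k] on the event [e s = k], so after taking the
    expectation over [eps 0 = i] and exchanging it with the integral over [s]
    (fubini_bounded), everything reduces to the numbers
      [E [eps 0 = i, eps s = k, exp (- int_s^t gamma (eps u) du)]].
    By the Markov property at time [s] and homogeneity such a number is
    [P (eps 0 = i, eps s = k)] times the mean [psi_k (t - s)] of the same
    functional started afresh in [k] (markov_exp); and [P (eps s = k | eps 0 = i)]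
    is [pi_ik s], because the state at time [s] differs from the initial one
    exactly when the number of switchings is odd (switchings_parity).

    Three points need care.  The Markov hypothesis concerns one future instant
    only, whereas the exponential depends on the whole future of the path: it is
    a limit of products of functions of the states at the points of a regular
    grid, for which the property follows by induction on the number of factors
    (markov_product), and dominated convergence passes to the limit.  The
    right-hand side of the differential equation jumps, so the equation is solved
    with right derivatives: a left-continuous function whose right derivative
    vanishes everywhere is constant (right_derivative0_constant).  Finally,
    measurability in time, and jointly in time and outcome, comes from the
    right-continuity of paths through approximation by step functions on grids
    (measurable_right_continuous2), and that of [Gamma t] in the outcome from
    Riemann sums (cvg_Riemann_sum). *)

Set Implicit Arguments. Unset Strict Implicit. Unset Printing Implicit Defensive.

(** * Real induction and the parity of switchings *)

Lemma near_rightE {R : realType} (x : R) (Q : R -> Prop) :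
  (\forall u \near x^'+, Q u) -> exists2 r, 0 < r & forall u, x < u < x + r -> Q u.
Proof.
case/nbhs_ballP => r /= r0 h; exists r => // u /andP[xu ur].
by apply: h => //; rewrite /ball/= ltr0_norm ?subr_lt0//; lra.
Qed.

Lemma near_leftE {R : realType} (x : R) (Q : R -> Prop) :
  (\forall u \near x^'-, Q u) -> exists2 r, 0 < r & forall u, x - r < u < x -> Q u.
Proof.
case/nbhs_ballP => r /= r0 h; exists r => // u /andP[xu ur].
by apply: h => //; rewrite /ball/= gtr0_norm ?subr_gt0//; lra.
Qed.

(** The infimum of the failures of [Q] is not itself a failure, and [Q] persists
    on a right neighbourhood of it. *)
Lemma real_induction {R : realType} (Q : R -> Prop) :
  Q 0 ->
  (forall s, 0 <= s -> Q s -> \forall u \near s^'+, Q u) ->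
  (forall s, 0 < s -> (forall u, 0 <= u < s -> Q u) -> Q s) ->
  forall t, 0 <= t -> Q t.
Proof.
move=> Q0 Qr Ql t t0; apply: contrapT => nQt.
pose A := [set u | 0 <= u /\ ~ Q u]; pose m := inf A.
have A0 : A !=set0 by exists t.
have lbA : lbound A 0 by move=> u [].
have m0 : 0 <= m by exact: lb_le_inf.
have below u : 0 <= u < m -> Q u.
  move=> /andP[u0 um]; apply: contrapT => nQu.
  have : m <= u by apply: ge_inf; [exists 0|].
  by rewrite leNgt um.
have Qm : Q m.
  by move: m0; rewrite le_eqVlt => /predU1P[<-//|m0]; exact: Ql.
have [r r0 hr] := near_rightE (Qr _ m0 Qm).
have [//|u [u0 nQu] umr] := @inf_adherent _ A r r0; first by split => //; exists 0.
have mu : m <= u by apply: ge_inf; [exists 0|].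
apply: nQu; move: mu; rewrite le_eqVlt => /predU1P[<-//|mu].
by apply: hr; rewrite mu.
Qed.

Section parity.
Context {R : realType} (e : R -> bool) (he : cadlag_path e).

Lemma no_switching_interval (b : bool) (s u : R) :
  (forall v, s < v <= u -> e v = b) -> 0 <= s <= u ->
  switching_times e u = switching_times e s.
Proof.
move=> eb /andP[s0 su]; apply/seteqP; split => v [/andP[v0 vu] hv]; split => //.
  rewrite v0/= leNgt; apply/negP => sv.
  have [r r0 hr] := near_leftE hv.
  (* a point of ]s, v[ close enough to v to carry the opposite state *)
  pose w := Num.max ((s + v) / 2) (v - r / 2).
  have wv : w < v by rewrite gt_max; apply/andP; split; lra.
  have sw : s < w by rewrite lt_max; apply/orP; left; lra.
  have rw : v - r < w by rewrite lt_max; apply/orP; right; lra.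
  have := hr w; rewrite rw wv => /(_ isT).
  by rewrite !eb ?eqxx ?sv ?sw//= (le_trans (ltW wv)).
by rewrite v0 (le_trans vu su).
Qed.

(** By real induction on [t], together with the finiteness that makes the count
    meaningful: a path keeps its value to the right of each time, so no switching
    is added there, and it has a left limit, so at most one is added at the time
    itself, namely when the left limit differs from the value. *)
Lemma switchings_parity t : 0 <= t ->
  finite_set (switching_times e t) /\ odd (nb_switchings e t) = (e 0 != e t).
Proof.
move: t; apply: real_induction => [|s s0 [fs os]|s s0 hs].
- rewrite /nb_switchings eqxx; have -> : switching_times e 0 = set0.
    by apply/seteqP; split => // v [] /andP[v0]; rewrite leNgt v0.
  split; first exact: finite_set0.
  by rewrite fset_set0 cardfs0.
- have [r r0 hr] := near_rightE (he.1 s s0).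
  near=> u.
  have su : s < u by near: u; exact: nbhs_right_gt.
  have us : u < s + r by near: u; apply: nbhs_right_lt; lra.
  have E : switching_times e u = switching_times e s.
    apply: (@no_switching_interval (e s)); last by rewrite s0 ltW.
    by move=> v /andP[sv vu]; apply: hr; rewrite sv (le_lt_trans vu).
  rewrite /nb_switchings E; split => //.
  by rewrite -/(nb_switchings e s) os (hr u)// su.
- have [b hb] := he.2 s s0.
  have [r r0 hr] := near_leftE hb.
  pose u := Num.max (s / 2) (s - r / 2).
  have u0 : 0 <= u by rewrite le_max; apply/orP; left; lra.
  have us : u < s by rewrite gt_max; apply/andP; split; lra.
  have ru : s - r < u by rewrite lt_max; apply/orP; right; lra.
  have [|fu ou] := hs u; first by rewrite u0.
  have eu : e u = b by apply: hr; rewrite ru.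
  (* no switching at s when its left limit b is e s, exactly one otherwise *)
  have [esb|esb] := eqVneq (e s) b.
    have E : switching_times e s = switching_times e u.
      apply: (@no_switching_interval b); last by rewrite u0 ltW.
      move=> v /andP[uv]; rewrite le_eqVlt => /predU1P[->//|vs].
      by apply: hr; rewrite vs (lt_trans ru).
    by rewrite /nb_switchings E; split => //; rewrite -/(nb_switchings e u) ou eu esb.
  have E : switching_times e s = s |` switching_times e u.
    apply/seteqP; split => v.
      move=> [/andP[v0 vs] hv]; have [->|vns] := eqVneq v s; [by left|right].
      have {}vs : v < s by rewrite lt_neqAle vns.
      (* v < s: compare with a time strictly between max(u, v) and s, up to which e is b *)
      rewrite -(@no_switching_interval b u ((s + Num.max u v) / 2)).
      + split => //; rewrite v0/=; have : v <= Num.max u v by rewrite le_max lexx orbT.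
        by lra.
      + move=> w /andP[uw wsv]; apply: hr; rewrite (lt_trans ru uw)/=.
        have : Num.max u v < s by rewrite gt_max us.
        by lra.
      + rewrite u0/=; have : u <= Num.max u v by rewrite le_max lexx.
        by lra.
    case => [->|[/andP[v0 vu] hv]]; split => //; first by rewrite s0 lexx.
      by apply: filterS hb => w ->; rewrite eq_sym.
    by rewrite v0 (le_trans vu)// ltW.
  have snu : s \notin fset_set (switching_times e u).
    by rewrite in_fset_set//; apply/negP; rewrite inE => -[/andP[_ +] _]; rewrite leNgt us.
  rewrite /nb_switchings E; split; first by rewrite finite_setU; split => //; exact: finite_set1.
  rewrite fset_setU1// cardfsU1 snu/= -/(nb_switchings e u) ou eu.
  by move: esb; case: (e 0) (e s) b {hb hr eu} => -[] [].
Unshelve. all: by end_near. Qed.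

End parity.

(** * Right-continuous functions: measurability and Riemann sums *)

Section grid.
Context {R : realType}.
Implicit Types (h u : R) (f : R -> R).

Definition right_continuous f := forall u, f v @[v --> u^'+] --> f u.

(** The first multiple of [h] lying strictly above [u]; the strict inequality is
    what lets limits along [grid h u] be limits from the right. *)
Definition grid h u : R := h * (Num.floor (u / h) + 1)%:~R.

Lemma grid_itv h u : 0 < h -> u < grid h u <= u + h.
Proof.
move=> h0; have /andP[f1 f2] := floor_itv (u / h).
rewrite /grid (mulrC h) -ltr_pdivrMr// f2/= intrD mulrDl mul1r lerD2r.
by rewrite -ler_pdivlMr.
Qed.

Lemma cvg_grid f u (h : R^nat) : (forall n, 0 < h n) ->
  h n @[n --> \oo] --> 0 -> f v @[v --> u^'+] --> f u ->
  f (grid (h n) u) @[n --> \oo] --> f u.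
Proof.
move=> h0 hc /cvg_at_rightP; apply; split.
  by move=> n; have /andP[] := grid_itv u (h0 n).
apply: (@squeeze_cvgr _ _ _ _ (fun=> u) (fun n => u + h n)).
- by near=> n; have /andP[/ltW -> ->] := grid_itv u (h0 n).
- exact: cvg_cst.
- by rewrite -[X in _ --> X]addr0; apply: cvgD => //; exact: cvg_cst.
Unshelve. all: by end_near. Qed.

(** [grid h] takes countably many values, each on a half-open interval, so that
    measurability of [F] in its second argument at each fixed time is enough. *)
Lemma measurable_grid d (T : measurableType d) (F : R -> T -> R) h :
  0 < h -> (forall s, measurable_fun setT (F s)) ->
  measurable_fun setT (fun p : measurableTypeR R * T => F (grid h p.1) p.2).
Proof.
move=> h0 mF _ Y mY; rewrite setTI.
rewrite [X in measurable X](_ : _ = \bigcup_(z : int)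
  (`[z%:~R * h, (z + 1)%:~R * h[%classic `*` (F (h * (z + 1)%:~R) @^-1` Y))).
  apply: countable_bigcupT_measurable; first exact: countableP.
  move=> z; apply: measurableX; first exact: measurable_itv.
  by rewrite -[X in measurable X]setTI; exact: mF.
apply/seteqP; split => [[s w]/= Fsw|[s w] [z _] [/=]].
  exists (Num.floor (s / h)) => //; split => //=.
  by rewrite in_itv/= -ler_pdivlMr// -ltr_pdivrMr// floor_itv.
rewrite in_itv/= -ler_pdivlMr// -ltr_pdivrMr// => /floor_def zE.
by rewrite /grid zE.
Qed.

Lemma cvg_invn r : (r / n.+1%:R : R) @[n --> \oo] --> 0.
Proof.
by rewrite -[X in _ --> X](mulr0 r); apply: cvgM; [exact: cvg_cst|exact: cvg_harmonic].
Qed.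

(** Right-continuity makes [F] the pointwise limit of the functions
    [F (grid h s) w] as [h] tends to 0. *)
Lemma measurable_right_continuous2 d (T : measurableType d) (F : R -> T -> R) :
  (forall s, measurable_fun setT (F s)) -> (forall w, right_continuous (F ^~ w)) ->
  measurable_fun setT (fun p : measurableTypeR R * T => F p.1 p.2).
Proof.
move=> mF cF.
apply: (@measurable_fun_cvg _ _ _ _ (fun n p => F (grid (1 / n.+1%:R) p.1) p.2)).
  by move=> n; apply: measurable_grid => //; rewrite divr_gt0.
move=> [s w] _ /=; apply: (@cvg_grid (F ^~ w) s (fun n => 1 / n.+1%:R)); last exact: cF.
  by move=> n; rewrite divr_gt0.
exact: cvg_invn.
Qed.

Lemma measurable_right_continuous f : right_continuous f -> measurable_fun setT f.
Proof.
move=> cf.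
have := @measurable_right_continuous2 _ unit (fun u _ => f u) _ (fun=> cf).
move=> /(_ (fun=> @measurable_cst _ _ _ _ _ _)) mf.
rewrite (_ : f = (fun p : R * unit => f p.1) \o (fun u => (u, tt)))//.
by apply: measurableT_comp => //; apply: measurable_fun_pair => //.
Qed.

Lemma bounded_integrable d (T : measurableType d) (m : {measure set T -> \bar R})
    (D : set T) (f : T -> R) (M : R) : measurable D -> (m D < +oo)%E ->
  measurable_fun D f -> (forall x, D x -> `|f x| <= M) -> m.-integrable D (EFin \o f).
Proof.
move=> mD Doo mf fM; apply: measurable_bounded_integrable => //.
exists M; split; first exact: num_real.
by move=> x Mx y Dy /=; rewrite (le_trans (fM y Dy))// ltW.
Qed.

Lemma itv_measure_lty (a b : R) (x y : bool) :
  (lebesgue_measure [set` Interval (BSide x a) (BSide y b)] < +oo)%E.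
Proof.
by rewrite lebesgue_measure_itv/=; case: ifP => _; rewrite -?EFinB ltry.
Qed.

Lemma Rintegral_grid f (s h : R) (m : nat) (M : R) : 0 < h ->
  (forall u, `|f u| <= M) ->
  \int[lebesgue_measure]_(u in `[s, s + m%:R * h[) f (s + grid h (u - s)) =
  h * \sum_(j < m) f (s + j.+1%:R * h).
Proof.
move=> h0 fM.
have mf : measurable_fun setT (fun u => f (s + grid h (u - s))).
  rewrite (_ : (fun u => _) = (fun p : measurableTypeR R * unit => f (s + grid h p.1)) \o
    (fun u => (u - s, tt)))//.
  apply: measurableT_comp.
    exact: (@measurable_grid _ unit (fun u _ => f (s + u))).
  by apply: measurable_fun_pair => //; apply: measurable_funB => //.
elim: m => [|m IH].
  by rewrite mul0r addr0 set_itvco0 Rintegral_set0 big_ord0 mulr0.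
have smh : s + m%:R * h <= s + m.+1%:R * h.
  by rewrite lerD2l ler_pM2r// ler_nat.
have -> : `[s, s + m.+1%:R * h[%classic =
    `[s, s + m%:R * h[ `|` `[s + m%:R * h, s + m.+1%:R * h[.
  apply: itv_bndbnd_setU; rewrite bnd_simp//.
  by rewrite lerDl mulr_ge0// ltW.
rewrite Rintegral_setU//=; first last.
- apply/disj_set2P/seteqP; split => // u [] /=; rewrite !in_itv/= => /andP[_ +] /andP[+ _].
  by rewrite leNgt => ->.
- apply: (@bounded_integrable _ _ _ _ _ M) => //.
  + exact: measurableU.
  + rewrite -itv_bndbnd_setU ?bnd_simp//; first exact: itv_measure_lty.
    by rewrite lerDl mulr_ge0// ltW.
  + exact: measurable_funTS.
rewrite IH big_ord_recr/= mulrDr; congr (_ + _).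
rewrite (@eq_Rintegral _ _ _ _ _ (fun=> f (s + m.+1%:R * h))); last first.
  move=> u; rewrite inE/= in_itv/= -lerBrDl -ltrBlDl => usm.
  rewrite /grid (_ : Num.floor _ = m%:Z).
    by rewrite -addn1 natrD intrD mulrC.
  apply: floor_def; rewrite intrD ler_pdivlMr// ltr_pdivrMr//.
  by move: usm; rewrite -[m.+1]addn1 natrD.
rewrite Rintegral_cst//= lebesgue_measure_itv/= lte_fin ltrD2l ltr_pM2r// ltr_nat ltnSn.
by rewrite -EFinB/= mulrC; congr (_ * _); rewrite -[m.+1]addn1 natrD; lra.
Qed.

(** The sum at right endpoints is the integral of a step function (Rintegral_grid)
    that converges pointwise, so bounded convergence applies. *)
Lemma cvg_Riemann_sum f (s r M : R) : 0 <= r -> (forall u, `|f u| <= M) ->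
  right_continuous f ->
  (r / n.+1%:R) * \sum_(j < n.+1) f (s + j.+1%:R * (r / n.+1%:R)) @[n --> \oo] -->
  \int[lebesgue_measure]_(u in `[s, s + r]) f u.
Proof.
rewrite le_eqVlt => /predU1P[<- _ _|r0 fM cf].
  rewrite addr0 set_itv1 Rintegral_set1.
  by under eq_fun do rewrite mul0r mul0r; exact: cvg_cst.
have mf := measurable_right_continuous cf.
have h0 n : 0 < r / n.+1%:R by rewrite divr_gt0.
have If : lebesgue_measure.-integrable `[s, s + r[ (EFin \o f).
  apply: (@bounded_integrable _ _ _ _ _ M) => //; first exact: itv_measure_lty.
  exact: measurable_funTS.
rewrite -Rintegral_itv_bndo_bndc//.
have E n : r / n.+1%:R * \sum_(j < n.+1) f (s + j.+1%:R * (r / n.+1%:R)) =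
    \int[lebesgue_measure]_(u in `[s, s + r[) f (s + grid (r / n.+1%:R) (u - s)).
  rewrite -(@Rintegral_grid f s (r / n.+1%:R) n.+1 M)//.
  by rewrite [n.+1%:R * _]mulrC divfK.
under eq_fun do rewrite E.
apply: fine_cvg; rewrite fineK; last exact: integrable_fin_num.
have mco : measurable (`[s, s + r[%classic : set R) by exact: measurable_itv.
apply: (@dominated_cvg _ _ _ lebesgue_measure _ mco (fun n u => (f (s + grid (r / n.+1%:R) (u - s)))%:E)
   _ (fun=> M%:E)) => //.
- move=> n; apply/measurable_EFinP; apply: measurable_funTS.
  rewrite (_ : (fun u => _) = (fun p : measurableTypeR R * unit => f (s + grid (r / n.+1%:R) p.1)) \o
    (fun u => (u - s, tt)))//.
  apply: measurableT_comp.
    exact: (@measurable_grid _ unit (fun u _ => f (s + u))).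
  by apply: measurable_fun_pair => //; apply: measurable_funB => //.
- move=> u _; apply: cvg_EFin; first by near=> n.
  have := @cvg_grid (fun v => f (s + v)) (u - s) _ h0 (cvg_invn r).
  rewrite subrKC; apply; apply/cvg_at_rightP => v [v1 v2].
  move/cvg_at_rightP : (cf u); apply; split.
    by move=> n; rewrite -ltrBlDl.
  by rewrite -[X in _ --> X](subrKC s); apply: cvgD => //; exact: cvg_cst.
- apply: (@bounded_integrable _ _ _ _ (cst M) M) => //.
    exact: itv_measure_lty.
  by move=> u _ /=; rewrite ger0_norm// (le_trans _ (fM 0)).
- by move=> n u _ /=; rewrite lee_fin.
Unshelve. all: by end_near. Qed.

End grid.

(** * Right derivatives *)

Section right_derivative.
Context {R : realType}.
Implicit Types (f g : R -> R) (s l : R).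

Lemma near_cvg f g (F : set_system R) (l : R) : Filter F ->
  (\forall u \near F, f u = g u) -> f u @[u --> F] --> l -> g u @[u --> F] --> l.
Proof. by move=> FF fg; apply: cvg_trans; exact: near_eq_cvg. Qed.

Definition right_derivative f s l :=
  (f u - f s) / (u - s) @[u --> s^'+] --> l.

Lemma right_derivative_cvg f s l :
  right_derivative f s l -> f u @[u --> s^'+] --> f s.
Proof.
move=> fl; apply: (@near_cvg (fun u => f s + (u - s) * ((f u - f s) / (u - s)))).
  near=> u; have su : s < u by near: u; exact: nbhs_right_gt.
  by rewrite mulrC divfK ?subrKC// subr_eq0 gt_eqF.
rewrite -[X in _ --> X]addr0 -[X in _ --> _ + X](mul0r l).
apply: cvgD; first exact: cvg_cst.
apply: cvgM => //; apply: cvg_at_right_filter.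
by rewrite -[X in _ --> X](subrr s); apply: cvgB; [exact: cvg_id|exact: cvg_cst].
Unshelve. all: by end_near. Qed.

Lemma right_derivativeB f g s l m : right_derivative f s l -> right_derivative g s m ->
  right_derivative (fun u => f u - g u) s (l - m).
Proof.
move=> fl gm; apply: near_cvg (cvgB fl gm).
by near=> u => /=; rewrite -mulrBl; congr (_ / _); ring.
Unshelve. all: by end_near. Qed.

Lemma right_derivativeM f g s l m : right_derivative f s l -> right_derivative g s m ->
  right_derivative (fun u => f u * g u) s (l * g s + f s * m).
Proof.
move=> fl gm.
apply: (@near_cvg (fun u => (f u - f s) / (u - s) * g s + f u * ((g u - g s) / (u - s)))).
  by near=> u => /=; rewrite mulrAC mulrA -mulrDl; congr (_ / _); ring.
apply: cvgD; first by apply: cvgM => //; exact: cvg_cst.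
by apply: cvgM => //; exact: right_derivative_cvg fl.
Unshelve. all: by end_near. Qed.

(** Squeeze the difference quotient between the two bounds that come from [(p - q) e^q <= e^p - e^q <= (p - q) e^p]. *)
Lemma right_derivative_expR f s l : right_derivative f s l ->
  right_derivative (fun u => expR (f u)) s (l * expR (f s)).
Proof.
move=> fl; have cef : expR (f u) @[u --> s^'+] --> expR (f s).
  by apply: continuous_cvg (right_derivative_cvg fl); exact: continuous_expR.
apply: (@squeeze_cvgr _ _ _ _ (fun u => (f u - f s) / (u - s) * expR (f s))
   (fun u => (f u - f s) / (u - s) * expR (f u))).
- near=> u; have su : 0 < u - s by rewrite subr_gt0; near: u; exact: nbhs_right_gt.
  rewrite ![_ / _ * expR _]mulrAC !ler_pM2r ?invr_gt0//.
  have expB p q : (p - q) * expR q <= expR p - expR q.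
    have := expR_ge1Dx (p - q); rewrite expRB ler_pdivlMr ?expR_gt0//.
    by rewrite mulrDl mul1r lerBrDl.
  by rewrite expB/= -[leLHS]opprB -[leRHS]opprK lerN2 -mulNr opprB expB.
- by apply: cvgM => //; exact: cvg_cst.
- exact: cvgM.
Unshelve. all: by end_near. Qed.

(** For each [c > 0] the bound [|f u - f 0| <= c u] propagates by real induction:
    to the right by the vanishing right derivative, at a limit time by
    left-continuity. *)
Lemma right_derivative0_constant f :
  (forall s, 0 <= s -> right_derivative f s 0) ->
  (forall s, 0 < s -> f u @[u --> s^'-] --> f s) ->
  forall t, 0 <= t -> f t = f 0.
Proof.
move=> fr fl t t0; apply/eqP; rewrite -subr_eq0 -normr_le0.
apply/ler_addgt0Pr => eps eps0; rewrite add0r.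
suff bound (c : R) : 0 < c -> forall u, 0 <= u -> `|f u - f 0| <= c * u.
  have t1 : 0 < t + 1 by rewrite ltr_wpDl.
  (* t + 1 rather than t, which may vanish *)
  apply: (le_trans (bound (eps / (t + 1)) _ _ t0)); first by rewrite divr_gt0.
  by rewrite mulrAC ler_pdivrMr// ler_pM2l//; lra.
move=> c0; apply: real_induction => [|s s0 fs|s s0 fs].
- by rewrite subrr normr0 mulr0.
- have /cvgr_dist_le/(_ _ c0) := fr s s0; apply: filter_app.
  near=> u; have su : 0 < u - s by rewrite subr_gt0; near: u; exact: nbhs_right_gt.
  rewrite sub0r normrN normrM normfV (gtr0_norm su) ler_pdivrMr// => fus.
  rewrite -(subrK (f s) (f u)) -addrA (le_trans (ler_normD _ _))//.
  by rewrite (le_trans (lerD fus fs))//; lra.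
- apply/ler_addgt0Pr => d d0.
  have /cvgrPdist_le/(_ _ d0)/near_leftE[r r0 hr] := fl s s0.
  pose u := Num.max (s / 2) (s - r / 2).
  have u0 : 0 <= u by rewrite le_max; apply/orP; left; lra.
  have us : u < s by rewrite gt_max; apply/andP; split; lra.
  have ru : s - r < u by rewrite lt_max; apply/orP; right; lra.
  rewrite -(subrK (f u) (f s)) -addrA (le_trans (ler_normD _ _))// [leRHS]addrC lerD//.
    by apply: hr; rewrite ru.
  by rewrite (le_trans (fs u _)) ?u0// ler_pM2l// ltW.
Unshelve. all: by end_near. Qed.

Lemma integrable_itvS f (b u : R) : u <= b ->
  lebesgue_measure.-integrable `[0, b] (EFin \o f) ->
  lebesgue_measure.-integrable `[0, u] (EFin \o f).
Proof.
move=> ub; apply: integrableS => //.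
by move=> v /=; rewrite !in_itv/= => /andP[-> /le_trans->].
Qed.

Lemma Rintegral_itv0B f (s u : R) : 0 <= s <= u ->
  lebesgue_measure.-integrable `[0, u] (EFin \o f) ->
  \int[lebesgue_measure]_(v in `[0, u]) f v - \int[lebesgue_measure]_(v in `[0, s]) f v =
  \int[lebesgue_measure]_(v in `[s, u]) f v.
Proof.
move=> /andP[s0 su] fi; rewrite Rintegral_itvB// ?bnd_simp// Rintegral_itv_obnd_cbnd//.
apply: integrableS fi => //.
by move=> v /=; rewrite !in_itv/= => /andP[/ltW/(le_trans s0)->].
Qed.

Lemma right_derivative_integral f (b s : R) : 0 <= s < b ->
  lebesgue_measure.-integrable `[0, b] (EFin \o f) ->
  f u @[u --> s^'+] --> f s ->
  right_derivative (fun u => \int[lebesgue_measure]_(v in `[0, u]) f v) s (f s).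
Proof.
move=> /andP[s0 sb] fi fs; apply/cvgrPdist_le => eps eps0.
have /cvgrPdist_le/(_ _ eps0)/near_rightE[r r0 hr] := fs.
near=> u; have su : s < u by near: u; exact: nbhs_right_gt.
have ub : u < b by near: u; exact: nbhs_right_lt.
have ur : u < s + r by near: u; apply: nbhs_right_lt; lra.
have us0 : 0 < u - s by rewrite subr_gt0.
rewrite Rintegral_itv0B ?s0 ?(ltW su)//; last exact: integrable_itvS (ltW ub) fi.
have fsu : lebesgue_measure.-integrable `[s, u] (EFin \o f).
  apply: (integrableS _ _ _ fi) => //.
  by move=> v /=; rewrite !in_itv/= => /andP[/(le_trans s0)-> /le_trans->//]; exact: ltW.
have csu (k : R) : lebesgue_measure.-integrable `[s, u] (EFin \o (fun=> k)).
  by apply: (@bounded_integrable _ _ _ _ _ _ `|k|) => //; exact: itv_measure_lty.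
have Ek (k : R) : \int[lebesgue_measure]_(v in `[s, u]) k = k * (u - s).
  by rewrite Rintegral_cst//= lebesgue_measure_itv/= lte_fin su -EFinB.
have -> : f s = (\int[lebesgue_measure]_(v in `[s, u]) f s) / (u - s).
  by rewrite Ek mulfK// gt_eqF.
rewrite -mulrBl -RintegralB// normrM normfV (gtr0_norm us0) ler_pdivrMr// -Ek.
have isub : lebesgue_measure.-integrable `[s, u] (EFin \o (fun v => f s - f v)).
  rewrite (_ : _ \o _ = (EFin \o (fun=> f s)) \- (EFin \o f))%E//.
  exact: integrableB.
apply: (le_trans (le_normr_Rintegral _ _)) => //.
apply: le_Rintegral => //.
  rewrite (_ : _ \o _ = abse \o (EFin \o (fun v => f s - f v))) ; last by [].
  exact: integrable_abse.
move=> v /=; rewrite in_itv/= => /andP[]; rewrite le_eqVlt => /predU1P[<- _|sv vu].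
  by rewrite subrr normr0 ltW.
by apply: hr; rewrite sv (le_lt_trans vu).
Unshelve. all: by end_near. Qed.

(** Paths are only controlled at nonnegative times; extending them by their
    value at 0 gives functions that are right-continuous on the whole line. *)
Lemma right_continuous_max0 f :
  (forall u, 0 <= u -> f v @[v --> u^'+] --> f u) ->
  right_continuous (fun u => f (Num.max 0 u)).
Proof.
move=> cf u; have [u0|u0] := leP 0 u.
  apply: near_cvg (cf u u0).
  near=> v; have uv : u <= v by near: v; exact: nbhs_right_ge.
  by rewrite max_r// (le_trans u0).
apply: (@near_cvg (fun=> f 0)); last exact: cvg_cst.
by near=> v; rewrite max_l//; near: v; exact: nbhs_right_le.
Unshelve. all: by end_near. Qed.

Lemma measurable_right_continuous_pos f (b : R) :
  (forall u, 0 <= u -> f v @[v --> u^'+] --> f u) -> measurable_fun `[0, b] f.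
Proof.
move=> cf; apply: (eq_measurable_fun (fun u : R => f (Num.max 0 u))).
  by move=> u; rewrite inE/= in_itv/= => /andP[u0 _]; rewrite max_r.
by apply: measurable_funTS; apply: measurable_right_continuous; exact: right_continuous_max0.
Qed.

End right_derivative.

(** * Solution of the equation along one path *)

Section path.
Context {R : realType} (e : R -> bool) (he : cadlag_path e).

Lemma state_bound (F : bool -> R) b : `|F b| <= `|F true| + `|F false|.
Proof. by case: b; rewrite ?lerDl ?lerDr. Qed.

Lemma cadlag_right_cvg (F : bool -> R) s : 0 <= s -> F (e u) @[u --> s^'+] --> F (e s).
Proof.
move=> s0; apply: (@near_cvg _ (fun=> F (e s))); last exact: cvg_cst.
by apply: filterS (he.1 s s0) => u ->.
Qed.

Lemma cadlag_integrable (F : bool -> R) b :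
  lebesgue_measure.-integrable `[0, b] (EFin \o (F \o e)).
Proof.
apply: (@bounded_integrable _ _ _ _ _ _ (`|F true| + `|F false|)) => //.
- exact: itv_measure_lty.
- by apply: measurable_right_continuous_pos; exact: cadlag_right_cvg.
- by move=> u _; exact: state_bound.
Qed.

Lemma right_derivative_Gamma gamma s : 0 <= s ->
  right_derivative (Gamma gamma e) s (gamma (e s)).
Proof.
move=> s0; apply: (@right_derivative_integral _ (gamma \o e) (s + 1)).
- by rewrite s0/= ltrDl.
- exact: cadlag_integrable.
- exact: cadlag_right_cvg.
Qed.

Lemma Gamma_cvg_left gamma s : 0 < s -> Gamma gamma e u @[u --> s^'-] --> Gamma gamma e s.
Proof.
by move=> s0; exact: (parameterized_integral_cvg_at_left s0 (cadlag_integrable gamma s)).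
Qed.

Lemma Gamma0 gamma : Gamma gamma e 0 = 0.
Proof. by rewrite /Gamma set_itv1 Rintegral_set1. Qed.

Lemma GammaB gamma s u : 0 <= s <= u ->
  Gamma gamma e u - Gamma gamma e s = \int[lebesgue_measure]_(v in `[s, u]) gamma (e v).
Proof. by move=> su; apply: (@Rintegral_itv0B _ (gamma \o e)) => //; exact: cadlag_integrable. Qed.

Lemma le_Gamma gamma s u : (forall i, 0 < gamma i) -> 0 <= s <= u ->
  Gamma gamma e s <= Gamma gamma e u.
Proof.
move=> g0 su; rewrite -subr_ge0 GammaB//.
by apply: Rintegral_ge0 => v _; exact: ltW.
Qed.

(** With [E = exp Gamma], the function [E X - int E a(e)] has right derivative
    [gamma E X + E (a - gamma X) - E a = 0], hence keeps its initial value [x]. *)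
Lemma ou_path_formula (a gamma : bool -> R) (x : R) (X : R -> R) t :
  (forall i, 0 < gamma i) -> ou_path a gamma x e X -> 0 <= t ->
  X t = x * expR (- Gamma gamma e t) +
    \int[lebesgue_measure]_(s in `[0, t])
       (a (e s) * expR (- (Gamma gamma e t - Gamma gamma e s))).
Proof.
move=> g0 [X0 Xc XE] t0.
have [Xcont X0r] := (continuous_within_itvcyP 0 X).1 Xc.
have Xr s : 0 <= s -> X u @[u --> s^'+] --> X s.
  rewrite le_eqVlt => /predU1P[<-//|s0]; apply: cvg_at_right_filter.
  by apply: Xcont; rewrite in_itv/= s0.
have Xl s : 0 < s -> X u @[u --> s^'-] --> X s.
  by move=> s0; apply: cvg_at_left_filter; apply: Xcont; rewrite in_itv/= s0.
have Xbnd b : exists M, forall u, u \in `[0, b] -> `|X u| <= M.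
  have cX : {within `[0, b], continuous X}.
    apply: continuous_subspaceW Xc => u /=; rewrite !in_itv/= => /andP[-> _] //.
  have /compact_bounded[M [_ hM]] := continuous_compact cX (@segment_compact _ 0 b).
  (* boundedness only provides bounds strictly larger than M *)
  exists (M + 1) => u ub; apply: hM; first by rewrite ltrDl.
  by exists u.
pose f u := a (e u) - gamma (e u) * X u.
pose E u := expR (Gamma gamma e u).
have fr s : 0 <= s -> f u @[u --> s^'+] --> f s.
  move=> s0; apply: cvgB; first exact: cadlag_right_cvg.
  by apply: cvgM; [exact: cadlag_right_cvg|exact: Xr].
have fi b : lebesgue_measure.-integrable `[0, b] (EFin \o f).
  have [M hM] := Xbnd b.
  apply: (@bounded_integrable _ _ _ _ _ _ ((`|a true| + `|a false|) +
     (`|gamma true| + `|gamma false|) * M)) => //.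
  - exact: itv_measure_lty.
  - exact: measurable_right_continuous_pos.
  - move=> u ub; rewrite (le_trans (ler_normB _ _))// lerD ?state_bound//.
    by rewrite normrM ler_pM ?state_bound// hM.
have Xd s : 0 <= s -> right_derivative X s (f s).
  move=> s0; have sb : 0 <= s < s + 1 by rewrite s0/= ltrDl.
  apply: near_cvg (right_derivative_integral sb (fi _) (fr s s0)).
  near=> u; have su : s < u by near: u; exact: nbhs_right_gt.
  rewrite [X u]XE ?(le_trans s0 (ltW su))// [X s]XE//.
  by congr (_ / _); rewrite opprD addrACA subrr add0r.
have Ed s : 0 <= s -> right_derivative E s (gamma (e s) * E s).
  by move=> s0; apply: right_derivative_expR; exact: right_derivative_Gamma.
have Er s : 0 <= s -> E u @[u --> s^'+] --> E s.
  by move=> s0; exact: right_derivative_cvg (Ed s s0).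
pose h u := E u * a (e u).
have hr s : 0 <= s -> h u @[u --> s^'+] --> h s.
  by move=> s0; apply: cvgM; [exact: Er|exact: cadlag_right_cvg].
have hi b : lebesgue_measure.-integrable `[0, b] (EFin \o h).
  apply: (@bounded_integrable _ _ _ _ _ _ (E b * (`|a true| + `|a false|))) => //.
  - exact: itv_measure_lty.
  - exact: measurable_right_continuous_pos.
  - move=> u /=; rewrite in_itv/= => ub; rewrite normrM ler_pM ?state_bound//.
    by rewrite ger0_norm ?expR_ge0// ler_expR le_Gamma.
pose H u := \int[lebesgue_measure]_(v in `[0, u]) h v.
pose Y u := E u * X u - H u.
have Y0 s : 0 <= s -> right_derivative Y s 0.
  move=> s0; have sb : 0 <= s < s + 1 by rewrite s0/= ltrDl.
  have := right_derivativeB (right_derivativeM (Ed s s0) (Xd s s0))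
    (right_derivative_integral sb (hi _) (hr s s0)).
  by rewrite (_ : _ - _ = 0)// /f /h; ring.
have Yl s : 0 < s -> Y u @[u --> s^'-] --> Y s.
  move=> s0; apply: cvgB; last exact: (parameterized_integral_cvg_at_left s0 (hi s)).
  apply: cvgM; last exact: Xl.
  by rewrite /E; apply: continuous_cvg (@Gamma_cvg_left gamma _ s0); exact: continuous_expR.
have := right_derivative0_constant Y0 Yl t0.
rewrite /Y /E /H Gamma0 expR0 X0 set_itv1 Rintegral_set1 subr0 mul1r => /eqP.
rewrite subr_eq => /eqP EX.
have -> : X t = expR (- Gamma gamma e t) * (expR (Gamma gamma e t) * X t).
  by rewrite mulrA -expRD addNr expR0 mul1r.
rewrite EX mulrDr mulrC; congr (_ + _); rewrite -RintegralZl//.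
apply: eq_Rintegral => s _; rewrite /h /E opprB addrC expRD; ring.
Unshelve. all: by end_near. Qed.

End path.

(** * The Markov property for products along a grid *)

Section markov.
Context {R : realType} {d : measure_display} {T : measurableType d}.
Variables (P : probability T R) (eps : R -> T -> bool) (lambda : bool -> R).
Hypothesis eps_markov : two_state_markov P eps lambda.
Hypothesis eps0_gt0 : forall i, (0 < P (in_state eps 0 i))%E.

Lemma measurable_in_state s k : 0 <= s -> measurable (in_state eps s k).
Proof. by move=> s0; exact: (tsm_measurable eps_markov). Qed.

Lemma measurable_filtration s A : natural_filtration eps s A -> measurable A.
Proof.
apply; split; first exact: sigma_algebra_measurable.
by move=> _ [u [i [/andP[u0 _] ->]]]; exact: measurable_in_state.
Qed.

Lemma filtration_step s h k A : 0 <= s -> 0 <= h -> natural_filtration eps s A ->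
  natural_filtration eps (s + h) (A `&` in_state eps s k).
Proof.
move=> s0 h0 sA.
pose G := [set B | exists (u : R) (i : bool), 0 <= u <= s + h /\ B = in_state eps u i].
apply: (@measurableI _ (g_sigma_algebraType G)).
  apply: sA; split; first exact: smallest_sigma_algebra.
  move=> _ [u [i [/andP[u0 us] ->]]]; apply: sub_gen_smallest; exists u, i; split => //.
  by rewrite u0 (le_trans us)// lerDl.
by apply: sub_gen_smallest; exists s, k; rewrite s0 lerDl.
Qed.

Lemma probability_fin A : measurable A -> P A \is a fin_num.
Proof. by move=> mA; exact: fin_num_measure. Qed.

(** When the conditioning event is null both sides vanish; otherwise this is the
    Markov property followed by homogeneity. *)
Lemma markov_step s h k l A : 0 <= s -> 0 <= h -> natural_filtration eps s A ->
  fine (P (A `&` in_state eps s k `&` in_state eps (s + h) l)) =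
  fine (P (A `&` in_state eps s k)) * cprob P (in_state eps h l) (in_state eps 0 k).
Proof.
move=> s0 h0 sA; have mA := measurable_filtration sA.
have mB : measurable (A `&` in_state eps s k).
  by apply: measurableI => //; exact: measurable_in_state.
have mC : measurable (in_state eps (s + h) l) by apply: measurable_in_state; exact: addr_ge0.
have := measure_ge0 P (A `&` in_state eps s k); rewrite le_eqVlt => /predU1P[P0|P0].
  rewrite -P0 mul0r [X in fine X](_ : _ = 0%E)//.
  by apply/eqP; rewrite -measure_le0 P0 le_measure ?inE//; exact: measurableI.
have <- : cprob P (in_state eps (s + h) l) (A `&` in_state eps s k) =
    cprob P (in_state eps h l) (in_state eps 0 k).
  rewrite (tsm_markov eps_markov)// -[in RHS](add0r h).
  apply: (tsm_homogeneous eps_markov) => //; apply: lt_le_trans P0 _.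
  by rewrite le_measure ?inE//; exact: measurable_in_state.
rewrite /cprob [X in fine (P X) / _]setIC mulrC divfK// gt_eqF// fine_gt0// P0/=.
by rewrite -ge0_fin_numE// probability_fin.
Qed.

Lemma measurable_state (F : bool -> R) s : 0 <= s ->
  measurable_fun setT (fun w => F (eps s w)).
Proof.
move=> s0; rewrite (_ : (fun w => _) =
  (fun w => F true * \1_(in_state eps s true) w + F false * \1_(in_state eps s false) w)).
  by apply: measurable_funD; apply: measurable_funM => //;
    apply: measurable_indic; exact: measurable_in_state.
have indE b w : \1_(in_state eps s b) w = (eps s w == b)%:R :> R.
  rewrite indicE (_ : (w \in in_state eps s b) = (eps s w == b))//.
  by apply/idP/eqP; rewrite inE.
by apply/funext => w; rewrite !indE; case: (eps s w); rewrite !(mulr1, mulr0, addr0, add0r).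
Qed.

Lemma measurable_state_product (F : bool -> R) s h n : 0 <= s -> 0 <= h ->
  measurable_fun setT (fun w => \prod_(j < n) F (eps (s + j.+1%:R * h) w)).
Proof.
move=> s0 h0; elim: n => [|n IH].
  by under eq_fun do rewrite big_ord0; exact: measurable_cst.
under eq_fun do rewrite big_ord_recr/=.
apply: measurable_funM => //; apply: measurable_state.
by rewrite addr_ge0// mulr_ge0.
Qed.

Lemma state_product_bounded (F : bool -> R) s h n w : (forall b, 0 <= F b <= 1) ->
  `|\prod_(j < n) F (eps (s + j.+1%:R * h) w)| <= 1.
Proof.
move=> F01; rewrite ger0_norm; first by apply: prodr_ile1 => i _; exact: F01.
by apply: prodr_ge0 => i _; have /andP[] := F01 (eps (s + i.+1%:R * h) w).
Qed.

Lemma bounded_expectation (f : T -> R) A : measurable A -> measurable_fun setT f ->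
  (forall w, `|f w| <= 1) -> P.-integrable A (EFin \o f).
Proof.
move=> mA mf f1; apply: (@bounded_integrable _ _ _ _ _ _ 1) => //.
  by rewrite (le_lt_trans (probability_le1 P mA))// ltry.
exact: measurable_funTS.
Qed.

(** The constant [V k] is the mean of the product for a start in [k].  It obeys
    the backward recursion obtained by conditioning on the state at time [s + h],
    and the essential point is that it depends neither on [s] nor on the past
    event [A]. *)
Lemma markov_product (F : bool -> R) h n : (forall b, 0 <= F b <= 1) -> 0 <= h ->
  exists V : bool -> R, forall s k A, 0 <= s -> natural_filtration eps s A ->
    \int[P]_(w in A `&` in_state eps s k) \prod_(j < n) F (eps (s + j.+1%:R * h) w) =
    fine (P (A `&` in_state eps s k)) * V k.
Proof.
move=> F01 h0; elim: n => [|n [V hV]].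
  exists (fun=> 1) => s k A s0 sA.
  under eq_Rintegral do rewrite big_ord0.
  rewrite Rintegral_cst ?mulr1 ?mul1r//; apply: measurableI.
    exact: measurable_filtration sA.
  exact: measurable_in_state.
pose p k l := cprob P (in_state eps h l) (in_state eps 0 k).
(* first-step analysis: p k l is the probability of going from k to l in time h *)
exists (fun k => p k true * (F true * V true) + p k false * (F false * V false)) => s k A s0 sA.
pose B := A `&` in_state eps s k.
have sh0 : 0 <= s + h by exact: addr_ge0.
have sB : natural_filtration eps (s + h) B by exact: filtration_step.
have mB := measurable_filtration sB.
have mBl l : measurable (B `&` in_state eps (s + h) l).
  by apply: measurableI => //; exact: measurable_in_state.
have BE : B = (B `&` in_state eps (s + h) true) `|` (B `&` in_state eps (s + h) false).
  apply/seteqP; split => [w Bw|w [[]|[]]//].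
  by case E : (eps (s + h) w); [left|right].
(* on the event eps (s + h) = l the first factor is the constant F l *)
have Bl l : \int[P]_(w in B `&` in_state eps (s + h) l)
      \prod_(j < n.+1) F (eps (s + j.+1%:R * h) w) =
    fine (P B) * (p k l * (F l * V l)).
  rewrite (@eq_Rintegral _ _ _ P _
      (fun w => F l * \prod_(j < n) F (eps (s + h + j.+1%:R * h) w))); last first.
    move=> w; rewrite inE => -[_ wl]; rewrite big_ord_recl/= mul1r wl; congr (_ * _).
    apply: eq_bigr => j _; congr (F (eps _ w)).
    by rewrite /bump/= -addrA -{2}[h]mul1r -mulrDl add1n -[j.+2]add1n natrD.
  rewrite RintegralZl//; last first.
    apply: bounded_expectation => //; first exact: measurable_state_product.
    by move=> w; exact: state_product_bounded.
  rewrite hV// markov_step// -/B -/(p k l); ring.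
rewrite -/B {1}BE Rintegral_setU//.
- by rewrite !Bl mulrDr.
- rewrite -BE; apply: bounded_expectation => //; first exact: measurable_state_product.
  by move=> w; exact: state_product_bounded.
- apply/disj_set2P/seteqP; split => // w [[_ wt] [_]].
  by rewrite /in_state/= wt.
Qed.

End markov.

(** * Exchange of expectation and time integral *)

Section product.
Context {R : realType} {d : measure_display} {T : measurableType d}.
Variables (P : probability T R).
Local Notation mu := (@lebesgue_measure R).

(** Tonelli's theorem for [g] cut off outside [0, t] x A; it also yields the
    measurability, hence the integrability, of both partial integrals. *)
Lemma fubini_bounded (g : R -> T -> R) (t : R) (A : set T) :
  measurable A ->
  measurable_fun setT (fun p : measurableTypeR R * T => g p.1 p.2) ->
  (forall s w, 0 <= g s w) ->
  (forall s w, 0 <= s <= t -> g s w <= 1) ->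
  [/\ P.-integrable A (EFin \o (fun w => \int[mu]_(s in `[0, t]) g s w)),
      mu.-integrable `[0, t] (EFin \o (fun s => \int[P]_(w in A) g s w)) &
      \int[P]_(w in A) \int[mu]_(s in `[0, t]) g s w =
      \int[mu]_(s in `[0, t]) \int[P]_(w in A) g s w].
Proof.
move=> mA mg g0 g1.
(* the cut-off turns both partial integrals into integrals over whole spaces *)
pose f (p : measurableTypeR R * T) : \bar R :=
  (g p.1 p.2 * \1_(`[0, t]%classic) p.1 * \1_A p.2)%:E.
have f0 p : (0%R <= f p)%E by rewrite lee_fin !mulr_ge0.
have mf : measurable_fun setT f.
  apply/measurable_EFinP; apply: measurable_funM.
    apply: measurable_funM => //.
    by apply: (@measurableT_comp _ _ _ _ _ _ (\1_(`[0, t]%classic) : R -> R)) => //; exact: measurable_indic.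
  by apply: (@measurableT_comp _ _ _ _ _ _ (\1_A : T -> R)) => //; exact: measurable_indic.
have mgs w : measurable_fun setT (g ^~ w).
  rewrite (_ : g ^~ w = (fun p : measurableTypeR R * T => g p.1 p.2) \o (fun s => (s, w)))//.
  by apply: measurableT_comp => //; apply: measurable_fun_pair.
have mgw s : measurable_fun setT (g s).
  rewrite (_ : g s = (fun p : measurableTypeR R * T => g p.1 p.2) \o (fun w => (s, w)))//.
  by apply: measurableT_comp => //; apply: measurable_fun_pair.
have igs w : mu.-integrable `[0, t] (EFin \o (g ^~ w)).
  apply: (@bounded_integrable _ _ _ _ _ _ 1) => //; first exact: itv_measure_lty.
    exact: (measurable_funTS (mgs w)).
  by move=> s /=; rewrite in_itv/= => st; rewrite ger0_norm// g1.
have igw s : 0 <= s <= t -> P.-integrable A (EFin \o g s).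
  move=> st; apply: bounded_expectation => // w.
  by rewrite ger0_norm// g1.
have Ff s : `[0, t]%classic s -> fubini_F P f s = (\int[P]_(w in A) g s w)%:E.
  move=> st; rewrite /Rintegral fineK; last by apply: integrable_fin_num => //; apply: igw.
  rewrite integral_mkcond; apply: eq_integral => w _.
  by rewrite /f/= !indicE (mem_set st) mulr1 patchE; case: ifPn => _; rewrite ?mulr1 ?mulr0.
have Ff0 s : ~ `[0, t]%classic s -> fubini_F P f s = 0%E.
  move=> st; rewrite -[RHS](integral0 P setT); apply: eq_integral => w _.
  by rewrite /f/= !indicE (memNset st) mulr0 mul0r.
have Gf w : A w -> fubini_G mu f w = (\int[mu]_(s in `[0, t]) g s w)%:E.
  move=> Aw; rewrite /Rintegral fineK; last by apply: integrable_fin_num => //; apply: igs.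
  rewrite [RHS]integral_mkcond; apply: eq_integral => s _.
  by rewrite /f/= !indicE (mem_set Aw) mulr1 patchE; case: ifPn => _; rewrite ?mulr1 ?mulr0.
have Gf0 w : ~ A w -> fubini_G mu f w = 0%E.
  move=> Aw; rewrite -[RHS](integral0 mu setT); apply: eq_integral => s _.
  by rewrite /f/= !indicE (memNset Aw) mulr0.
have Rcst (c : R) : \int[mu]_(s in `[0, t]) c = c * fine (mu `[0, t]) by rewrite Rintegral_cst.
split.
- apply: (@bounded_integrable _ _ _ _ _ _ (fine (mu `[0, t]))) => //.
  + by rewrite (le_lt_trans (probability_le1 P mA))// ltry.
  + apply/measurable_EFinP.
    apply: (eq_measurable_fun (fubini_G mu f)); first by move=> w; rewrite inE => /Gf.
    by apply: measurable_funTS; exact: measurable_fun_fubini_tonelli_G.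
  + move=> w _; rewrite ger0_norm ?Rintegral_ge0// -[leRHS]mul1r -Rcst.
    apply: le_Rintegral => //.
      by apply: (@bounded_integrable _ _ _ _ _ _ 1) => //; [exact: itv_measure_lty|move=> s _; rewrite normr1].
    by move=> s /=; rewrite in_itv/= => st; exact: g1.
- apply: (@bounded_integrable _ _ _ _ _ _ 1) => //; first exact: itv_measure_lty.
  + apply/measurable_EFinP.
    apply: (eq_measurable_fun (fubini_F P f)); first by move=> s; rewrite inE => /Ff.
    by apply: measurable_funTS; exact: measurable_fun_fubini_tonelli_F.
  + move=> s /=; rewrite in_itv/= => st; rewrite ger0_norm ?Rintegral_ge0//.
    have : \int[P]_(w in A) g s w <= \int[P]_(w in A) 1.
      apply: le_Rintegral => //; first exact: igw.
        by apply: bounded_expectation => // w; rewrite normr1.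
      by move=> w _; exact: g1.
    move/le_trans; apply; rewrite Rintegral_cst// mul1r -lee_fin fineK ?probability_le1//.
    exact: fin_num_measure.
- rewrite {1}/Rintegral [in RHS]/Rintegral; congr fine.
  transitivity (\int[P]_w fubini_G mu f w)%E.
    rewrite integral_mkcond; apply: eq_integral => w _; rewrite patchE.
    by case: ifPn => [/set_mem Aw|/negP Aw]; [rewrite Gf|rewrite Gf0// => /mem_set].
  transitivity (\int[mu]_s fubini_F P f s)%E.
    by rewrite /fubini_F /fubini_G -fubini_tonelli.
  rewrite [RHS]integral_mkcond; apply: eq_integral => s _; rewrite patchE.
  by case: ifPn => [/set_mem st|/negP st]; [rewrite Ff|rewrite Ff0// => /mem_set].
Qed.

End product.

(** * Exponential functionals and the conditional mean *)

Section mean.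
Context {R : realType} {d : measure_display} {T : measurableType d}.
Variables (P : probability T R) (eps : R -> T -> bool) (lambda gamma : bool -> R).
Hypothesis eps_markov : two_state_markov P eps lambda.
Hypothesis eps0_gt0 : forall i, (0 < P (in_state eps 0 i))%E.
Hypothesis gamma_gt0 : forall i, 0 < gamma i.
Local Notation mu := (@lebesgue_measure R).
Local Notation G s w := (Gamma gamma (eps ^~ w) s).
Let cadlag w : cadlag_path (eps ^~ w) := tsm_cadlag eps_markov w.

Lemma cvg_Gamma_sum s r w : 0 <= s -> 0 <= r ->
  r / n.+1%:R * \sum_(j < n.+1) gamma (eps (s + j.+1%:R * (r / n.+1%:R)) w)
    @[n --> \oo] --> G (s + r) w - G s w.
Proof.
move=> s0 r0; rewrite GammaB ?s0 ?lerDl//.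
pose f u := gamma (eps (Num.max 0 u) w).
have fc : right_continuous f.
  apply: (@right_continuous_max0 _ (fun u => gamma (eps u w))) => u u0.
  exact: (@cadlag_right_cvg _ (eps ^~ w)).
have -> : \int[mu]_(u in `[s, s + r]) gamma (eps u w) = \int[mu]_(u in `[s, s + r]) f u.
  apply: eq_Rintegral => u; rewrite inE/= in_itv/= => /andP[su _].
  by rewrite /f max_r// (le_trans s0).
have fb u : `|f u| <= `|gamma true| + `|gamma false| by exact: state_bound.
under eq_fun => n.
  rewrite (eq_bigr (fun j : 'I_n.+1 => f (s + j.+1%:R * (r / n.+1%:R)))); last first.
    by move=> j _; rewrite /f max_r// addr_ge0// mulr_ge0// divr_ge0.
  over.
exact: (@cvg_Riemann_sum _ f s r _ r0 fb fc).
Qed.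

Lemma measurable_Gamma t : 0 <= t -> measurable_fun setT (fun w => G t w).
Proof.
move=> t0; apply: (@measurable_fun_cvg _ _ _ _ (fun n w =>
  t / n.+1%:R * \sum_(j < n.+1) gamma (eps (0 + j.+1%:R * (t / n.+1%:R)) w))).
  move=> n; apply: measurable_funM => //; apply: measurable_sum => j.
  apply: (measurable_state eps_markov).
  by rewrite addr_ge0// mulr_ge0// divr_ge0.
by move=> w _; have := @cvg_Gamma_sum 0 t w (lexx 0) t0; rewrite add0r Gamma0 subr0.
Qed.

Lemma cvg_exp_product s r w : 0 <= s -> 0 <= r ->
  \prod_(j < n.+1) expR (- (r / n.+1%:R * gamma (eps (s + j.+1%:R * (r / n.+1%:R)) w)))
    @[n --> \oo] --> expR (- (G (s + r) w - G s w)).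
Proof.
move=> s0 r0; under eq_fun do rewrite -expR_sum sumrN -mulr_sumr.
have csum := @cvg_Gamma_sum s r w s0 r0.
by apply: continuous_cvg (cvgN csum); exact: continuous_expR.
Qed.

Lemma exp_factor01 (c : R) b : 0 <= c -> 0 <= expR (- (c * gamma b)) <= 1.
Proof. by move=> c0; rewrite expR_ge0 expR_le1 oppr_le0 mulr_ge0// ltW. Qed.

Lemma measurable_exp_GammaB s t : 0 <= s -> 0 <= t ->
  measurable_fun setT (fun w => expR (- (G t w - G s w))).
Proof.
move=> s0 t0; apply: measurableT_comp; first exact: measurable_expR.
by apply: measurable_funN; apply: measurable_funB; exact: measurable_Gamma.
Qed.

Lemma exp_GammaB01 s t w : 0 <= s <= t -> 0 <= expR (- (G t w - G s w)) <= 1.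
Proof. by move=> st; rewrite expR_ge0 expR_le1 oppr_le0 subr_ge0 le_Gamma. Qed.

Lemma cvg_exp_expectation s r A : 0 <= s -> 0 <= r -> measurable A ->
  \int[P]_(w in A) \prod_(j < n.+1)
     expR (- (r / n.+1%:R * gamma (eps (s + j.+1%:R * (r / n.+1%:R)) w))) @[n --> \oo] -->
  \int[P]_(w in A) expR (- (G (s + r) w - G s w)).
Proof.
move=> s0 r0 mA.
have h0 n : 0 <= r / n.+1%:R by rewrite divr_ge0.
apply: fine_cvg; rewrite fineK; last first.
  apply: integrable_fin_num => //; apply: bounded_expectation => //.
    by apply: measurable_exp_GammaB => //; exact: addr_ge0.
  move=> w; have /andP[e0 e1] : 0 <= expR (- (G (s + r) w - G s w)) <= 1.
    by apply: exp_GammaB01; rewrite s0 lerDl.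
  by rewrite ger0_norm.
apply: (@dominated_cvg _ _ _ P _ mA (fun n w => (\prod_(j < n.+1)
     expR (- (r / n.+1%:R * gamma (eps (s + j.+1%:R * (r / n.+1%:R)) w))))%:E)
     _ (fun=> 1%:E)) => //.
- move=> n; apply/measurable_EFinP; apply: measurable_funTS.
  exact: (measurable_state_product eps_markov (fun b => expR (- (r / n.+1%:R * gamma b)))).
- by move=> w _; apply: cvg_EFin; [near=> n|exact: cvg_exp_product].
- by apply: (@bounded_expectation _ _ _ P (fun=> 1)) => // w; rewrite normr1.
- move=> n w _ /=; rewrite lee_fin.
  apply: (@state_product_bounded _ _ _ eps (fun b => expR (- (r / n.+1%:R * gamma b)))).
  by move=> b; exact: exp_factor01.
Unshelve. all: by end_near. Qed.

Lemma fine_initial_gt0 k : 0 < fine (P (in_state eps 0 k)).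
Proof.
apply: fine_gt0; rewrite eps0_gt0/= -ge0_fin_numE// (probability_fin P)//.
exact: (measurable_in_state eps_markov).
Qed.

Lemma integrable_exp_Gamma A t : measurable A -> 0 <= t ->
  P.-integrable A (EFin \o (fun w => expR (- G t w))).
Proof.
move=> mA t0; apply: (bounded_expectation P mA).
  have := measurable_exp_GammaB (lexx 0) t0.
  by under eq_fun do rewrite Gamma0 subr0.
move=> w; have /andP[e0 e1] := @exp_GammaB01 0 t w (introT andP (conj (lexx 0) t0)).
by move: e1; rewrite Gamma0 subr0 ger0_norm// expR_ge0.
Qed.

Lemma cexpE (f : T -> R) A : measurable A -> P.-integrable A (EFin \o f) ->
  cexp P f A = ((fine (P A))^-1 * \int[P]_(w in A) f w)%:E.
Proof.
by move=> mA fi; rewrite /cexp EFinM /Rintegral fineK//; exact: integrable_fin_num.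
Qed.

Lemma psiGammaE k r : 0 <= r -> psiGamma P eps gamma k r =
  (fine (P (in_state eps 0 k)))^-1 * \int[P]_(w in in_state eps 0 k) expR (- G r w).
Proof.
move=> r0; have mk := measurable_in_state eps_markov k (lexx 0).
by rewrite /psiGamma cexpE//; exact: integrable_exp_Gamma.
Qed.

(** The grid products for the two sides are proportional with the same ratio by
    markov_product, and so are their limits. *)
Lemma markov_exp s r k A : 0 <= s -> 0 <= r -> natural_filtration eps s A ->
  \int[P]_(w in A `&` in_state eps s k) expR (- (G (s + r) w - G s w)) =
  fine (P (A `&` in_state eps s k)) * psiGamma P eps gamma k r.
Proof.
move=> s0 r0 sA.
have mA := measurable_filtration eps_markov sA.
have m0 := measurable_in_state eps_markov k (lexx 0).
have mk := measurable_in_state eps_markov k s0.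
rewrite psiGammaE// mulrCA; apply: (@mulfI _ (fine (P (in_state eps 0 k)))).
  by rewrite gt_eqF// fine_initial_gt0.
rewrite mulVKf ?gt_eqF ?fine_initial_gt0//.
pose I s0 (B : set T) n := \int[P]_(w in B) \prod_(j < n.+1)
     expR (- (r / n.+1%:R * gamma (eps (s0 + j.+1%:R * (r / n.+1%:R)) w))).
(* both sides are P (eps 0 = k) P (A, eps s = k) times the same constant V k *)
have E n : fine (P (in_state eps 0 k)) * I s (A `&` in_state eps s k) n =
           fine (P (A `&` in_state eps s k)) * I 0 (in_state eps 0 k) n.
  have h0 : 0 <= r / n.+1%:R by rewrite divr_ge0.
  have [V hV] := markov_product eps_markov eps0_gt0 n.+1
    (fun b => exp_factor01 b h0) h0.
  rewrite /I hV//.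
  have := hV 0 k (in_state eps 0 k) (lexx 0); rewrite setIid => ->; first by ring.
  by apply: sub_gen_smallest; exists 0, k; rewrite lexx.
have lim1 : fine (P (in_state eps 0 k)) * I s (A `&` in_state eps s k) n @[n --> \oo] -->
    fine (P (in_state eps 0 k)) *
    \int[P]_(w in A `&` in_state eps s k) expR (- (G (s + r) w - G s w)).
  apply: cvgM; first exact: cvg_cst.
  by apply: cvg_exp_expectation => //; exact: measurableI.
have lim2 : fine (P (A `&` in_state eps s k)) * I 0 (in_state eps 0 k) n @[n --> \oo] -->
    fine (P (A `&` in_state eps s k)) *
    \int[P]_(w in in_state eps 0 k) expR (- G r w).
  apply: cvgM; first exact: cvg_cst.
  have := cvg_exp_expectation (lexx 0) r0 m0.
  by under [X in _ --> X -> _]eq_Rintegral do rewrite add0r Gamma0 subr0.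
move: lim1; under eq_fun do rewrite E; move=> lim1.
have E2 := cvg_unique (@Rhausdorff R) lim1 lim2.
by apply: E2.
Qed.

Lemma transitionE i k s : 0 <= s ->
  transition P eps i k s = cprob P (in_state eps s k) (in_state eps 0 i).
Proof.
move=> s0; rewrite /transition /cprob.
case: ifPn => ki; congr (fine (P _) / _); apply/seteqP; split => w []; rewrite /in_state/=;
  rewrite (switchings_parity (cadlag w) s0).2; move: ki;
  by case: (eps 0 w) (eps s w) k i => -[] [] [].
Qed.

(** The part of the integrand of ou_path_formula that multiplies [a k]; negative
    times are sent to 0 so that it is right-continuous in [s] on the whole line. *)
Definition occupation k t (s : R) (w : T) : R :=
  (eps (Num.max 0 s) w == k)%:R * expR (- (G t w - G (Num.max 0 s) w)).

Lemma measurable_occupation k t : 0 <= t ->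
  measurable_fun setT (fun p : measurableTypeR R * T => occupation k t p.1 p.2).
Proof.
move=> t0; apply: measurable_right_continuous2 => [s|w].
  have m0 : 0 <= Num.max 0 s by rewrite le_max lexx.
  apply: measurable_funM; last exact: measurable_exp_GammaB.
  exact: (measurable_state eps_markov (fun b => (b == k)%:R)).
apply: (@right_continuous_max0 _ (fun s => (eps s w == k)%:R * expR (- (G t w - G s w)))) => u u0.
apply: cvgM; first exact: (@cadlag_right_cvg _ _ (cadlag w) (fun b => (b == k)%:R)).
have Gr : G v w @[v --> u^'+] --> G u w.
  exact: (right_derivative_cvg (@right_derivative_Gamma _ _ (cadlag w) gamma _ u0)).
have GN : - (G t w - G v w) @[v --> u^'+] --> - (G t w - G u w).
  by apply: cvgN; apply: cvgB => //; exact: cvg_cst.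
by apply: continuous_cvg GN; exact: continuous_expR.
Qed.

(** Conditioning on the state at time [s], with [A] the event [eps 0 = i] of the
    past, leaves the transition probability times [psi_k (t - s)]. *)
Lemma mean_occupation i k t s : 0 <= s <= t ->
  \int[P]_(w in in_state eps 0 i) occupation k t s w =
  fine (P (in_state eps 0 i)) *
    (transition P eps i k s * psiGamma P eps gamma k (t - s)).
Proof.
move=> /andP[s0 st].
have sA : natural_filtration eps s (in_state eps 0 i).
  by apply: sub_gen_smallest; exists 0, i; rewrite lexx.
have ts0 : 0 <= t - s by rewrite subr_ge0.
rewrite mulrA transitionE// /cprob [X in fine (P X) / _]setIC.
rewrite [fine (P (in_state eps 0 i)) * _]mulrC divfK ?gt_eqF ?fine_initial_gt0//.
rewrite -markov_exp// subrKC Rintegral_mkcondr; apply: eq_Rintegral => w _.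
rewrite /occupation max_r// patchE.
case: ifPn => [|/negP]; first by rewrite inE => ->; rewrite eqxx mul1r.
move=> wk; rewrite (_ : (_ == _) = false) ?mul0r//.
by apply/eqP => wk'; apply: wk; rewrite inE.
Qed.

(** The two displayed formulas at once: [int_0^t occupation k t s w ds] is the
    coefficient of [a k] in the solution along the path of [w]. *)
Lemma mean_ou a x (X : R -> T -> R) i t :
  (forall w, ou_path a gamma x (eps ^~ w) (X ^~ w)) -> 0 <= t ->
  cexp P (X t) (in_state eps 0 i) =
    (x * psiGamma P eps gamma i t
     + a false * \int[mu]_(s in `[0, t])
         (transition P eps i false s * psiGamma P eps gamma false (t - s))
     + a true * \int[mu]_(s in `[0, t])
         (transition P eps i true s * psiGamma P eps gamma true (t - s)))%:E.
Proof.
move=> X_ou t0.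
set A := in_state eps 0 i.
have mA : measurable A by exact: (measurable_in_state eps_markov).
have A0 : fine (P A) != 0 by rewrite gt_eqF// fine_initial_gt0.
have g0 k s w : 0 <= occupation k t s w by rewrite mulr_ge0// expR_ge0.
have g1 k s w : 0 <= s <= t -> occupation k t s w <= 1.
  move=> /[dup] st /andP[s0 _]; have /andP[e0 e1] := exp_GammaB01 w st.
  rewrite /occupation max_r//; case: (_ == _); by rewrite ?mul1r ?mul0r.
have fub k := fubini_bounded P mA (measurable_occupation k t0) (g0 k) (g1 k).
pose H k w := \int[mu]_(s in `[0, t]) occupation k t s w.
have HE k : \int[P]_(w in A) H k w = fine (P A) * \int[mu]_(s in `[0, t])
         (transition P eps i k s * psiGamma P eps gamma k (t - s)).
  have [_ fi ->] := fub k.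
  rewrite (_ : \int[mu]_(s in _) (_ * _) = \int[mu]_(s in `[0, t])
     ((fine (P A))^-1 * \int[P]_(w in A) occupation k t s w)); last first.
    apply: eq_Rintegral => s; rewrite inE/= in_itv/= => st.
    by rewrite mean_occupation// mulKf.
  by rewrite RintegralZl// mulVKf.
have iH k : P.-integrable A (EFin \o H k) by have [] := fub k.
have io k w : mu.-integrable `[0, t] (EFin \o (fun s => occupation k t s w)).
  apply: (@bounded_integrable _ _ _ _ _ _ 1) => //; first exact: itv_measure_lty.
    apply: measurable_funTS.
    rewrite (_ : (fun s => _) = (fun p : measurableTypeR R * T => occupation k t p.1 p.2) \o
      (fun s => (s, w)))//.
    by apply: measurableT_comp; [exact: measurable_occupation|exact: measurable_fun_pair].
  by move=> s /=; rewrite in_itv/= => st; rewrite ger0_norm// g1.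
have iE : P.-integrable A (EFin \o (fun w => expR (- G t w))) by exact: integrable_exp_Gamma.
have iZ (f : T -> R) c : P.-integrable A (EFin \o f) -> P.-integrable A (EFin \o (fun w => c * f w)).
  move=> fi; rewrite (_ : _ \o _ = (fun w => c%:E * (EFin \o f) w)%E)//.
  exact: integrableZl.
have iD (f g : T -> R) : P.-integrable A (EFin \o f) -> P.-integrable A (EFin \o g) ->
    P.-integrable A (EFin \o (fun w => f w + g w)).
  by move=> fi gi; rewrite (_ : _ \o _ = (EFin \o f) \+ (EFin \o g))%E//; exact: integrableD.
have ioZ k w c : mu.-integrable `[0, t] (EFin \o (fun s => c * occupation k t s w)).
  rewrite (_ : _ \o _ = (fun s => c%:E * (EFin \o (fun s => occupation k t s w)) s)%E)//.
  by apply: integrableZl => //; exact: io.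
have XE : X t = fun w => x * expR (- G t w) + a false * H false w + a true * H true w.
  apply/funext => w.
  rewrite (ou_path_formula (cadlag w) gamma_gt0 (X_ou w) t0) -addrA; congr (_ + _).
  rewrite -!RintegralZl// -RintegralD//.
  apply: eq_Rintegral => s; rewrite inE/= in_itv/= => /andP[s0 st].
  by rewrite /occupation max_r//; case: (eps s w); rewrite !(mul0r, mulr0, mul1r, addr0, add0r).
rewrite XE cexpE//; last by apply: (iD (fun w => _ + _)); [apply: iD|]; apply: iZ.
congr EFin; rewrite !RintegralD//; do ?[exact: iZ|by apply: iD; apply: iZ].
by rewrite !RintegralZl// !HE psiGammaE// -/A; field.
Qed.

End mean.

Theorem mainTheorem4 (R : realType) (d : measure_display) (T : measurableType d)
  (P : probability T R) (eps : R -> T -> bool) (lambda a gamma : bool -> R)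
  (x : R) (X : R -> T -> R)
  (lambda_gt0 : forall i, 0 < lambda i)
  (gamma_gt0 : forall i, 0 < gamma i)
  (a_gamma : a true / gamma true < a false / gamma false)
  (eps_markov : two_state_markov P eps lambda)
  (eps0_gt0 : forall i, (0 < P (in_state eps 0 i))%E)
  (X_ou : forall w, ou_path a gamma x (eps ^~ w) (X ^~ w))
  (t : R) (t_ge0 : 0 <= t) :
  cexp P (X t) (in_state eps 0 false) =
    (x * psiGamma P eps gamma false t
     + a false * \int[lebesgue_measure]_(s in `[0, t])
         (transition P eps false false s * psiGamma P eps gamma false (t - s))
     + a true * \int[lebesgue_measure]_(s in `[0, t])
         (transition P eps false true s * psiGamma P eps gamma true (t - s)))%:E
  /\
  cexp P (X t) (in_state eps 0 true) =
    (x * psiGamma P eps gamma true t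
     + a false * \int[lebesgue_measure]_(s in `[0, t])
         (transition P eps true false s * psiGamma P eps gamma false (t - s))
     + a true * \int[lebesgue_measure]_(s in `[0, t])
         (transition P eps true true s * psiGamma P eps gamma true (t - s)))%:E.
Proof. by split; exact: (mean_ou eps_markov eps0_gt0 gamma_gt0). Qed.
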